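(* Let $A$ be a ring with divisors, $S$ a filter of $A$ not containing $0$, and $H_S$ the solid subgroup of $\mathrm{Div}\,A$ generated by the $\mathrm{div}_A(s)$ for $s\in S$. 1. The ring $A_S=S^{-1}A$ is a ring with divisors, and there is a unique morphism of lattice-ordered groups $\varphi_S:\mathrm{Div}\,A\to\mathrm{Div}\,A_S$ such that $\varphi_S(\mathrm{div}_A(a))=\mathrm{div}_{A_S}(a)$ for every $a\in A^*$. This morphism is surjective, hence $\mathrm{Div}\,A_S\simeq(\mathrm{Div}\,A)/\ker\varphi_S$. 2. One has $H_S^+=\{\alpha\in\mathrm{Div}\,A:\exists s\in S,\ 0\le\alpha\le\mathrm{div}_A(s)\}$, and the principal divisors in $H_S^+$ are the elements of $\mathrm{div}_A(S)$. 3. Suppose that $\mathrm{Div}\,A=H_S\boxplus H'$. Then $\varphi_S$ is a quotient morphism by $H_S$ (i.e. it is surjective with kernel $H_S$): it allows one to identify $\mathrm{Div}\,A_S$ with the quotient lattice-ordered group $(\mathrm{Div}\,A)/H_S\simeq H'$.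
   Context: Rings are commutative with unit. A ring is integral if every element is zero or regular; $A^*$ is the set of regular elements, $K$ the total ring of fractions of $A$, $K^*$ its set of regular elements. An element $g\in A^*$ is a strong gcd of $(a_1,\dots,a_n)$ in $A^*$ if for every $x\in A^*$, $xg$ is a gcd of $(xa_1,\dots,xa_n)$ in $A$. A list $(a_i)$ in $A^*$ is divisorially invertible if there is a list $(b_j)$ in $A^*$ such that $(a_ib_j)_{i,j}$ has a strong gcd. An integral ring is a ring with divisors (PvMD) if every nonempty finite list in $A^*$ (equivalently every nonzero finitely generated ideal) is divisorially invertible. For a ring with divisors, $\mathrm{div}_A:K^*\to\mathrm{Div}\,A$ is the (unique up to unique isomorphism) group morphism to a lattice-ordered group such that: $\mathrm{div}_A(x)\ge 0\iff x\in A$; and every element of $\mathrm{Div}\,A$ is the infimum of a finite family of elements $\mathrm{div}_A(x)$, $x\in K^*$. A principal divisor is an element $\mathrm{div}_A(x)$, $x\in K^*$. A filter of $A$ is a saturated multiplicative subset: $1\in S$ and ($xy\in S\iff x\in S$ and $y\in S$). A subgroup $H$ of a lattice-ordered group $G$ is solid if $\xi\in H$ and $|\zeta|\le|\xi|$ imply $\zeta\in H$; $H^+=H\cap G^+$. For lattice-ordered subgroups $H,L$ of $G$, $G=H\boxplus L$ means $G=H\oplus L$ and $H\perp L$ (i.e. $|x|\wedge|y|=0$ for $x\in H$, $y\in L$). *)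

(* Defs.v *)
From HB Require Import structures.
From mathcomp Require Import all_boot all_order all_algebra.
From mathcomp Require Import ring.
From mathcomp Require Import boolp classical_sets.
Set Implicit Arguments.
Unset Strict Implicit.
Unset Printing Implicit Defensive.
Import Order.TTheory GRing.Theory.
Local Open Scope classical_set_scope.
Local Open Scope order_scope.
Local Open Scope ring_scope.

Identity Coercion fun_of_set : set >-> Funclass.

Record ring_filter (A : comPzRingType) := RingFilter {
  filter_set :> set A;
  filter1 : filter_set 1;
  filterM : forall x y, filter_set (x * y) <-> filter_set x /\ filter_set y }.

Lemma regular1 (A : comPzRingType) : GRing.lreg (1 : A).
Proof. exact: lreg1. Qed.

Lemma regularM (A : comPzRingType) (x y : A) :
  GRing.lreg (x * y) <-> GRing.lreg x /\ GRing.lreg y.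
Proof.
split=> [xyr|[xr yr] u v]; last by rewrite -!mulrA => /xr /yr.
split=> u v /= e; apply: xyr; last by rewrite -!mulrA e.
by rewrite [x * y]mulrC -!mulrA e.
Qed.

(* A^*; regular elements form a filter in every commutative ring. *)
Definition regular_filter (A : comPzRingType) : ring_filter A :=
  @RingFilter A [set x | GRing.lreg x] (@regular1 A) (@regularM A).

(* S^-1 A as a quotient of A x S: a/s = b/t iff u(at - bs) = 0 for some u in S.
   No integrality is assumed, so the zero ring is allowed. *)
Module Localization.
Section Def.
Variables (A : comPzRingType) (S : ring_filter A).

Definition pair := (A * set_type S)%type.
HB.instance Definition _ := Choice.on pair.

Definition num (x : pair) : A := x.1.
Definition den (x : pair) : A := val x.2.
Lemma denP x : S (den x). Proof. exact: set_mem (valP x.2). Qed.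
Definition mk (a s : A) (Ss : S s) : pair := (a, SigSub (mem_set Ss)).

Definition equiv (x y : pair) : bool :=
  `[< exists2 u, S u & u * (num x * den y) = u * (num y * den x) >].

Lemma equiv_refl : reflexive equiv.
Proof. by move=> x; apply/asboolP; exists 1 => //; exact: filter1. Qed.

Lemma equiv_sym : symmetric equiv.
Proof.
by move=> x y; apply/asboolP/asboolP => -[u Su e]; exists u => //; rewrite e.
Qed.

Lemma equiv_trans : transitive equiv.
Proof.
move=> y x z /asboolP[u Su e1] /asboolP[v Sv e2]; apply/asboolP.
exists (u * v * den y); first by do ![apply/filterM; split] => //; exact: denP.
transitivity (v * den z * (u * (num x * den y))); first by ring.
rewrite e1; transitivity (u * den x * (v * (num y * den z))); first by ring.
by rewrite e2; ring.
Qed.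

Canonical equiv_equiv := EquivRel equiv equiv_refl equiv_sym equiv_trans.

Definition type := {eq_quot equiv}%qT.
HB.instance Definition _ : EqQuotient _ equiv type := EqQuotient.on type.
HB.instance Definition _ := Choice.on type.

Definition frac (x : pair) : type := (\pi_type x)%qT.

Lemma fracP (x y : pair) :
  frac x = frac y <-> exists2 u, S u & u * (num x * den y) = u * (num y * den x).
Proof.
split=> [/eqmodP /asboolP //|h]; apply/eqmodP; exact/asboolP.
Qed.

Lemma fracW (P : type -> Prop) : (forall x, P (frac x)) -> forall X, P X.
Proof. by move=> h X; rewrite -[X]reprK; exact: h. Qed.

Lemma den_mul x y : S (den x * den y).
Proof. by apply/filterM; split; exact: denP. Qed.

Definition add_pair x y := mk (num x * den y + num y * den x) (den_mul x y).
Definition mul_pair x y := mk (num x * num y) (den_mul x y).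
Definition opp_pair x := mk (- num x) (denP x).

Definition add (X Y : type) : type := frac (add_pair (repr X) (repr Y)).
Definition mul (X Y : type) : type := frac (mul_pair (repr X) (repr Y)).
Definition opp (X : type) : type := frac (opp_pair (repr X)).
Definition inj (a : A) : type := frac (mk a (filter1 S)).

Lemma reprP x : exists2 u, S u &
  u * (num (repr (frac x)) * den x) = u * (num x * den (repr (frac x))).
Proof. by apply/fracP; rewrite /frac reprK. Qed.

Lemma addE x y : add (frac x) (frac y) = frac (add_pair x y).
Proof.
apply/fracP; have [u Su eu] := reprP x; have [v Sv ev] := reprP y.
exists (u * v); first by apply/filterM.
rewrite /add_pair /num /den /= -/(num _) -/(den _).
move: (repr (frac x)) (repr (frac y)) eu ev => x' y' eu ev; rewrite -!/(num _) -!/(den _).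
transitivity (v * den y' * den y * (u * (num x' * den x)) +
              u * den x' * den x * (v * (num y' * den y))); first by ring.
by rewrite eu ev; ring.
Qed.

Lemma mulE x y : mul (frac x) (frac y) = frac (mul_pair x y).
Proof.
apply/fracP; have [u Su eu] := reprP x; have [v Sv ev] := reprP y.
exists (u * v); first by apply/filterM.
move: (repr (frac x)) (repr (frac y)) eu ev => x' y' eu ev.
rewrite /mul_pair /num /den /= -!/(num _) -!/(den _).
transitivity ((u * (num x' * den x)) * (v * (num y' * den y))); first by ring.
by rewrite eu ev; ring.
Qed.

Lemma oppE x : opp (frac x) = frac (opp_pair x).
Proof.
apply/fracP; have [u Su eu] := reprP x; exists u => //.
move: (repr _) eu => x' eu.
rewrite /opp_pair /num /den /= -!/(num _) -!/(den _).
by rewrite !mulNr !mulrN eu.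
Qed.

Lemma frac_ext x y : num x * den y = num y * den x -> frac x = frac y.
Proof. by move=> e; apply/fracP; exists 1; rewrite ?e //; exact: filter1. Qed.

Lemma addA : associative add.
Proof.
elim/fracW=> x; elim/fracW=> y; elim/fracW=> z; rewrite !addE; apply: frac_ext.
by rewrite /add_pair /num /den /=; ring.
Qed.

Lemma addC : commutative add.
Proof.
elim/fracW=> x; elim/fracW=> y; rewrite !addE; apply: frac_ext.
by rewrite /add_pair /num /den /=; ring.
Qed.

Lemma add0 : left_id (inj 0) add.
Proof.
elim/fracW=> x; rewrite addE; apply: frac_ext.
by rewrite /add_pair /num /den /=; ring.
Qed.

Lemma addN : left_inverse (inj 0) opp add.
Proof.
elim/fracW=> x; rewrite oppE addE; apply: frac_ext.
by rewrite /add_pair /opp_pair /num /den /=; ring.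
Qed.

HB.instance Definition _ := GRing.isZmodule.Build type addA addC add0 addN.

Lemma mulA : associative mul.
Proof.
elim/fracW=> x; elim/fracW=> y; elim/fracW=> z; rewrite !mulE; apply: frac_ext.
by rewrite /mul_pair /num /den /=; ring.
Qed.

Lemma mulC : commutative mul.
Proof.
elim/fracW=> x; elim/fracW=> y; rewrite !mulE; apply: frac_ext.
by rewrite /mul_pair /num /den /=; ring.
Qed.

Lemma mul1 : left_id (inj 1) mul.
Proof.
elim/fracW=> x; rewrite mulE; apply: frac_ext.
by rewrite /mul_pair /num /den /=; ring.
Qed.

Lemma mulD : left_distributive mul add.
Proof.
elim/fracW=> x; elim/fracW=> y; elim/fracW=> z.
rewrite !(addE, mulE); apply: frac_ext.
by rewrite /mul_pair /add_pair /num /den /=; ring.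
Qed.

HB.instance Definition _ := GRing.Zmodule_isComPzRing.Build type mulA mulC mul1 mulD.

Lemma inj_is_zmod_morphism : zmod_morphism inj.
Proof.
move=> a b; rewrite -[RHS]/(add (inj a) (opp (inj b))) oppE addE.
apply: frac_ext.
by rewrite /add_pair /opp_pair /num /den /=; ring.
Qed.

Lemma inj_is_monoid_morphism : monoid_morphism inj.
Proof.
split=> // a b; rewrite -[RHS]/(mul (inj a) (inj b)) mulE; apply: frac_ext.
by rewrite /mul_pair /num /den /=; ring.
Qed.

HB.instance Definition _ := GRing.isZmodMorphism.Build A type inj inj_is_zmod_morphism.
HB.instance Definition _ := GRing.isMonoidMorphism.Build A type inj inj_is_monoid_morphism.

End Def.
End Localization.
HB.export Localization.

Notation loc := Localization.type.

Definition locfrac (A : comPzRingType) (S : ring_filter A) (a s : A) (Ss : S s) :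
  loc S := Localization.frac (Localization.mk a Ss).

Notation toloc := Localization.inj.

Notation fracring A := (loc (regular_filter A)).
Notation tofracring A := (toloc (regular_filter A)).

Lemma locfracP (A : comPzRingType) (S : ring_filter A) (a b s t : A)
    (Ss : S s) (St : S t) :
  locfrac a Ss = locfrac b St <-> exists2 u, S u & u * (a * t) = u * (b * s).
Proof. exact: Localization.fracP. Qed.

Lemma locfrac_ex (A : comPzRingType) (S : ring_filter A) (x : loc S) :
  exists a s (Ss : S s), x = locfrac a Ss.
Proof.
elim/Localization.fracW: x => -[a s]; exists a, (val s), (set_mem (valP s)).
by apply: Localization.frac_ext.
Qed.

Lemma locfracM (A : comPzRingType) (S : ring_filter A) (a s : A) (Ss : S s) :
  locfrac a Ss * toloc S s = toloc S a.
Proof.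
rewrite -[LHS]/(Localization.mul (locfrac a Ss) (toloc S s)) Localization.mulE.
apply: Localization.frac_ext.
by rewrite /Localization.mul_pair /Localization.num /Localization.den /=; ring.
Qed.

Section RingsWithDivisors.
Variable A : comPzRingType.

Definition integral_ring := forall x : A, x = 0 \/ GRing.lreg x.

Definition divides (x y : A) := exists z, y = x * z.

(* x ranges over all of A: divisors of regular elements are regular. *)
Definition is_gcd (g : A) (s : seq A) :=
  forall x, divides x g <-> (forall a, a \in s -> divides x a).

Definition is_strong_gcd (g : A) (s : seq A) :=
  GRing.lreg g /\
  forall x, GRing.lreg x -> is_gcd (x * g) [seq x * a | a <- s].

Definition divisorially_invertible (s : seq A) :=
  exists2 t : seq A, (forall b, b \in t -> GRing.lreg b) &
    exists g, is_strong_gcd g [seq a * b | a <- s, b <- t].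

Definition ring_with_divisors :=
  integral_ring /\
  forall s : seq A, s <> [::] -> (forall a, a \in s -> GRing.lreg a) ->
    divisorially_invertible s.

End RingsWithDivisors.

(* Lattice-ordered groups are commutative and written additively. Divisor groups
   are commutative, being generated by the finite infima of a commutative group.
   Since the hierarchy has no join of [GRing.Zmodule] and [Order.Lattice], binary
   infima and suprema are added to [porderZmodType]. *)
HB.mixin Record isLGroup G of Num.POrderedZmodule G := {
  lg_meet : G -> G -> G;
  lg_join : G -> G -> G;
  lg_leD2_subproof : forall z x y : G, x <= y -> z + x <= z + y;
  lg_lexI : forall z x y : G, (z <= lg_meet x y) = (z <= x) && (z <= y);
  lg_leUx : forall z x y : G, (lg_join x y <= z) = (x <= z) && (y <= z) }.

#[short(type="lgroupType")]
HB.structure Definition LGroup := { G of Num.POrderedZmodule G & isLGroup G }.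

HB.mixin Record isLGroupMorphism (G G' : lgroupType) (f : G -> G') := {
  lg_morphI : {morph f : x y / lg_meet x y};
  lg_morphU : {morph f : x y / lg_join x y} }.

HB.structure Definition LGroupMorphism (G G' : lgroupType) :=
  { f of @GRing.Additive G G' f & isLGroupMorphism G G' f }.

Notation "{ 'lgmorphism' G -> G' }" :=
  (@LGroupMorphism.type G G')
  (at level 0, G at level 98, G' at level 99,
   format "{ 'lgmorphism'  G  ->  G' }") : type_scope.

Definition lg_abs (G : lgroupType) (x : G) := lg_join x (- x).

Section LGroupTheory.
Variable G : lgroupType.
Implicit Types x y z : G.

Lemma lg_leD2 z x y : x <= y -> z + x <= z + y.
Proof. exact: lg_leD2_subproof. Qed.
Lemma lg_leIl x y : lg_meet x y <= x.
Proof. by have := lexx (lg_meet x y); rewrite lg_lexI => /andP[]. Qed.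
Lemma lg_leIr x y : lg_meet x y <= y.
Proof. by have := lexx (lg_meet x y); rewrite lg_lexI => /andP[]. Qed.
Lemma lg_leUl x y : x <= lg_join x y.
Proof. by have := lexx (lg_join x y); rewrite lg_leUx => /andP[]. Qed.
Lemma lg_leUr x y : y <= lg_join x y.
Proof. by have := lexx (lg_join x y); rewrite lg_leUx => /andP[]. Qed.

Lemma lg_leD x y z t : x <= y -> z <= t -> x + z <= y + t.
Proof.
move=> xy zt; apply: le_trans (lg_leD2 y zt).
by rewrite ![_ + z]addrC; exact: lg_leD2.
Qed.

Lemma lg_subr_ge0 x y : (0 <= y - x) = (x <= y).
Proof.
apply/idP/idP => [/(lg_leD2 x)|/(lg_leD2 (- x))]; first by rewrite addr0 addrC subrK.
by rewrite addNr addrC.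
Qed.

Lemma lg_opp x y : (- x <= - y) = (y <= x).
Proof. by rewrite -[LHS]lg_subr_ge0 opprK addrC lg_subr_ge0. Qed.

Lemma lg_meetD z x y : z + lg_meet x y = lg_meet (z + x) (z + y).
Proof.
apply: le_anti; rewrite lg_lexI !lg_leD2 ?lg_leIl ?lg_leIr //=.
set m := lg_meet (z + x) _; rewrite -[m](subrKC z) lg_leD2 // lg_lexI.
have le t : m <= z + t -> m - z <= t by move=> /(lg_leD2 (- z)); rewrite addKr addrC.
by rewrite !le ?lg_leIl ?lg_leIr.
Qed.

Lemma lg_abs_ge0 x : 0 <= lg_abs x.
Proof.
set a := lg_abs x.
have a2 : 0 <= a + a by rewrite -(subrr x) lg_leD ?lg_leUl ?lg_leUr.
suff: 0 <= lg_meet a 0 by rewrite lg_lexI => /andP[].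
set b := lg_meet a 0; have [ba b0] := (lg_leIl a 0, lg_leIr a 0).
suff /(lg_leD2 (- b)) : b <= b + b by rewrite addNr addKr.
rewrite {2}/b lg_meetD addr0 lg_lexI lexx andbT addrC lg_meetD addr0.
by rewrite lg_lexI ba andbT (le_trans b0).
Qed.

Lemma lg_absN x : lg_abs (- x) = lg_abs x.
Proof.
by apply: le_anti; rewrite /lg_abs opprK !lg_leUx !lg_leUl !lg_leUr.
Qed.

Lemma lg_abs_id x : 0 <= x -> lg_abs x = x.
Proof.
move=> x0; apply: le_anti; rewrite /lg_abs lg_leUl lg_leUx lexx /= andbT.
by apply: (le_trans _ x0); rewrite -oppr0 lg_opp.
Qed.
End LGroupTheory.

Section Subgroups.
Variable G : lgroupType.

Definition subgroup (H : set G) := H 0 /\ forall x y, H x -> H y -> H (x - y).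

Definition solid_subgroup (H : set G) :=
  subgroup H /\ forall x y, H x -> lg_abs y <= lg_abs x -> H y.

Record solidSubgroup := SolidSubgroup {
  solid_set :> set G;
  solidP : solid_subgroup solid_set }.

Lemma smallest_solid (X : set G) : solid_subgroup (smallest solid_subgroup X).
Proof.
split; first split=> [M [[[]]] //|x y Hx Hy M MX].
  by case: (MX) => -[[_ sB] _] _; apply: sB; [exact: Hx | exact: Hy].
by move=> x y Hx yx M MX; case: (MX) => -[_ sol] _; apply: sol yx; exact: Hx.
Qed.

Definition solid_gen (X : set G) := SolidSubgroup (smallest_solid X).

Definition positive_part (H : set G) : set G := [set x | H x /\ 0 <= x].

Record lsubgroup := LSubgroup {
  lsub_set :> set G;
  lsub_subgroup : subgroup lsub_set;
  lsub_meet : forall x y, lsub_set x -> lsub_set y -> lsub_set (lg_meet x y);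
  lsub_join : forall x y, lsub_set x -> lsub_set y -> lsub_set (lg_join x y) }.

(* G = H [+] L: an internal direct sum of orthogonal subgroups. *)
Definition orthogonal_sum (H L : set G) :=
  [/\ forall z, exists x y, [/\ H x, L y & z = x + y],
      H `&` L = [set 0]
    & forall x y, H x -> L y -> lg_meet (lg_abs x) (lg_abs y) = 0].

End Subgroups.

Section Kernel.
Variables (G G' : lgroupType) (f : {lgmorphism G -> G' }).

Lemma lg_morph_abs x : f (lg_abs x) = lg_abs (f x).
Proof. by rewrite /lg_abs lg_morphU raddfN. Qed.

Lemma lg_ker_solid : solid_subgroup [set x | f x = 0].
Proof.
split; first split=> /= [|x y fx fy]; first exact: raddf0.
  by rewrite raddfB /= fx fy subr0.
have mono x y : x <= y -> f x <= f y.
  move=> xy; have -> : x = lg_meet x y.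
    by apply: le_anti; rewrite lg_leIl lg_lexI lexx xy.
  by rewrite lg_morphI lg_leIr.
move=> x y /= fx /mono; rewrite !lg_morph_abs fx [lg_abs 0]lg_abs_id // => fy0.
apply: le_anti; rewrite (le_trans (lg_leUl _ _) fy0) /= -lg_opp oppr0.
exact: le_trans (lg_leUr _ _) fy0.
Qed.

Definition lg_ker := SolidSubgroup lg_ker_solid.
End Kernel.

Section SubLGroup.
Variables (G : lgroupType) (H : lsubgroup G).

Definition lsub_pred (x : G) : bool := `[< H x >].

Lemma lsub_zmod_closed : zmod_closed lsub_pred.
Proof.
have [H0 HB] := lsub_subgroup H.
by split=> [|x y /asboolP Hx /asboolP Hy]; apply/asboolP => //; exact: HB.
Qed.
HB.instance Definition _ := GRing.isZmodClosed.Build G lsub_pred lsub_zmod_closed.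

Inductive lsub := LSub (x : G) of x \in lsub_pred.
Definition lsub_val (u : lsub) : G := let: LSub x _ := u in x.
HB.instance Definition _ := [isSub for lsub_val].
HB.instance Definition _ := [Choice of lsub by <:].
HB.instance Definition _ := [SubChoice_isSubZmodule of lsub by <:].
HB.instance Definition _ := Order.SubChoice_isSubPOrder.Build
  ring_display G lsub_pred ring_display lsub.

Lemma lsubP (u : lsub) : H (val u).
Proof. exact/asboolP/(valP u). Qed.

Definition lsub_meet_op (u v : lsub) : lsub :=
  LSub (asboolT (lsub_meet (lsubP u) (lsubP v))).
Definition lsub_join_op (u v : lsub) : lsub :=
  LSub (asboolT (lsub_join (lsubP u) (lsubP v))).

Lemma lsub_leD2 (z x y : lsub) : x <= y -> z + x <= z + y.
Proof. by rewrite -!Order.le_val !raddfD; exact: lg_leD2. Qed.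
Lemma lsub_lexI (z x y : lsub) : (z <= lsub_meet_op x y) = (z <= x) && (z <= y).
Proof. by rewrite -!Order.le_val /= lg_lexI. Qed.
Lemma lsub_leUx (z x y : lsub) : (lsub_join_op x y <= z) = (x <= z) && (y <= z).
Proof. by rewrite -!Order.le_val /= lg_leUx. Qed.
HB.instance Definition _ := isLGroup.Build lsub lsub_leD2 lsub_lexI lsub_leUx.
End SubLGroup.

Section Quotient.
Variables (G : lgroupType) (H : solidSubgroup G).

Definition solid_pred (x : G) : bool := `[< H x >].

Lemma solid_zmod_closed : zmod_closed solid_pred.
Proof.
have [[H0 HB] _] := solidP H.
by split=> [|x y /asboolP Hx /asboolP Hy]; apply/asboolP => //; exact: HB.
Qed.
HB.instance Definition _ :=
  GRing.isZmodClosed.Build G solid_pred solid_zmod_closed.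

Definition lquot := Quotient.quot (GRing.ZmodClosed.clone G solid_pred _).
HB.instance Definition _ := GRing.Zmodule.on lquot.

Definition lpi (x : G) : lquot := (\pi_lquot x)%qT.

Lemma lpiP x y : lpi x = lpi y <-> H (x - y).
Proof.
split=> [/eqP|h]; first by rewrite -Quotient.idealrBE => /asboolP.
by apply/eqP; rewrite -Quotient.idealrBE; exact/asboolP.
Qed.

Lemma lpiW (P : lquot -> Prop) : (forall x, P (lpi x)) -> forall X, P X.
Proof. by move=> h X; rewrite -[X]reprK; exact: h. Qed.

Lemma lpi_is_zmod_morphism : zmod_morphism lpi.
Proof. by move=> x y; rewrite /lpi !piE. Qed.
HB.instance Definition _ :=
  GRing.isZmodMorphism.Build G lquot lpi lpi_is_zmod_morphism.

(* The order of the quotient is the image of the order of [G]. *)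
Definition lquot_le (X Y : lquot) : bool :=
  `[< exists x y, [/\ X = lpi x, Y = lpi y & x <= y] >].

Lemma lquot_leP x y : lquot_le (lpi x) (lpi y) <-> exists2 h, H h & x <= y + h.
Proof.
have [[H0 HB] _] := solidP H.
have HN h : H h -> H (- h) by move=> Hh; rewrite -sub0r; exact: HB.
have HD g h : H g -> H h -> H (g + h).
  by move=> Hg /HN Hh; rewrite -[h]opprK; exact: HB.
split=> [/asboolP[x' [y' [/lpiP xx /lpiP yy le]]]|[h Hh le]].
  exists ((x - x') - (y - y')); first exact: HB.
  rewrite opprB addrCA (addrC y) subrK.
  by have := lg_leD2 (x - x') le; rewrite subrK.
apply/asboolP; exists x, (y + h); split=> //; apply/lpiP.
by rewrite opprD addrA subrr sub0r; exact: HN.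
Qed.

Lemma solidD x y : H x -> H y -> H (x + y).
Proof.
have [[H0 HB] _] := solidP H => Hx Hy.
have -> : x + y = x - (0 - y) by rewrite sub0r opprK.
by apply: (HB _ _ Hx); exact: HB.
Qed.

Lemma solid_abs x : H x -> H (lg_abs x).
Proof.
have [_ sol] := solidP H => Hx; apply: (sol _ _ Hx).
by rewrite [leLHS]lg_abs_id ?lg_abs_ge0.
Qed.

Lemma lquot_le_refl : reflexive lquot_le.
Proof. by elim/lpiW=> x; apply/asboolP; exists x, x. Qed.

Lemma lquot_le_trans : transitive lquot_le.
Proof.
elim/lpiW=> y; elim/lpiW=> x; elim/lpiW=> z.
move=> /lquot_leP[h Hh xy] /lquot_leP[k Hk yz]; apply/lquot_leP.
exists (k + h); first exact: solidD.
by rewrite (le_trans xy) // addrA lg_leD.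
Qed.

Lemma lquot_le_anti : antisymmetric lquot_le.
Proof.
elim/lpiW=> x; elim/lpiW=> y; case/andP=> /lquot_leP[h Hh xy] /lquot_leP[k Hk yx].
apply/lpiP; have [_ sol] := solidP H.
apply: (sol (lg_abs h + lg_abs k)); first by apply: solidD; exact: solid_abs.
have h0 := lg_abs_ge0 h; have k0 := lg_abs_ge0 k.
rewrite [leRHS]lg_abs_id; last by rewrite -[0]addr0 lg_leD.
have le (u v g : G) : u <= v + g -> u - v <= g.
  by move=> /(lg_leD2 (- v)); rewrite addKr addrC.
rewrite lg_leUx opprB; apply/andP; split.
  apply: le_trans (le _ _ _ xy) _; rewrite -[h in leLHS]addr0 lg_leD //.
  exact: lg_leUl.
apply: le_trans (le _ _ _ yx) _; rewrite -[k in leLHS]add0r lg_leD //.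
exact: lg_leUl.
Qed.

HB.instance Definition _ := Order.Le_isPOrder.Build ring_display lquot
  lquot_le_refl lquot_le_anti lquot_le_trans.

Lemma lpi_le x y : lpi x <= lpi y <-> exists2 h, H h & x <= y + h.
Proof. exact: lquot_leP. Qed.

Definition lquot_meet (X Y : lquot) : lquot := lpi (lg_meet (repr X) (repr Y)).
Definition lquot_join (X Y : lquot) : lquot := lpi (lg_join (repr X) (repr Y)).

Lemma lpi_repr (X : lquot) : lpi (repr X) = X.
Proof. exact: reprK. Qed.

Lemma lpi_homo x y : x <= y -> lpi x <= lpi y.
Proof. by move=> xy; apply/asboolP; exists x, y. Qed.

Lemma lpi_bound x y : lpi x <= lpi y -> exists h, [/\ H h, 0 <= h & x <= y + h].
Proof.
move=> /lpi_le[h Hh xy]; exists (lg_abs h); split=> //.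
- exact: solid_abs.
- exact: lg_abs_ge0.
- by rewrite (le_trans xy) // lg_leD2 // lg_leUl.
Qed.

Lemma lpi_lexI z x y : (lpi z <= lpi (lg_meet x y)) = (lpi z <= lpi x) && (lpi z <= lpi y).
Proof.
apply/idP/andP => [le|[/lpi_bound[h [Hh h0 zx]] /lpi_bound[k [Hk k0 zy]]]].
  by split; apply: le_trans le (lpi_homo _); rewrite ?lg_leIl ?lg_leIr.
apply/lpi_le; exists (h + k); first exact: solidD.
rewrite addrC lg_meetD lg_lexI; apply/andP; split.
  by rewrite addrC (le_trans zx) // lg_leD2 // -[leLHS]addr0 lg_leD2.
by rewrite addrC (le_trans zy) // lg_leD2 // -[leLHS]add0r lg_leD.
Qed.

Lemma lpi_leUx z x y : (lpi (lg_join x y) <= lpi z) = (lpi x <= lpi z) && (lpi y <= lpi z).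
Proof.
apply/idP/andP => [le|[/lpi_bound[h [Hh h0 zx]] /lpi_bound[k [Hk k0 zy]]]].
  by split; apply: le_trans (lpi_homo _) le; rewrite ?lg_leUl ?lg_leUr.
apply/lpi_le; exists (h + k); first exact: solidD.
rewrite lg_leUx; apply/andP; split.
  by rewrite (le_trans zx) // lg_leD2 // -[leLHS]addr0 lg_leD2.
by rewrite (le_trans zy) // lg_leD2 // -[leLHS]add0r lg_leD.
Qed.

Lemma lquot_leD2 (Z X Y : lquot) : X <= Y -> Z + X <= Z + Y.
Proof.
elim/lpiW: Z => z; elim/lpiW: X => x; elim/lpiW: Y => y /lpi_le[h Hh xy].
by rewrite -!raddfD; apply/lpi_le; exists h => //; rewrite -addrA lg_leD2.
Qed.

Lemma lquot_lexI (Z X Y : lquot) : (Z <= lquot_meet X Y) = (Z <= X) && (Z <= Y).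
Proof. by rewrite -[Z]lpi_repr lpi_lexI !lpi_repr. Qed.

Lemma lquot_leUx (Z X Y : lquot) : (lquot_join X Y <= Z) = (X <= Z) && (Y <= Z).
Proof. by rewrite -[Z]lpi_repr lpi_leUx !lpi_repr. Qed.

HB.instance Definition _ := isLGroup.Build lquot lquot_leD2 lquot_lexI lquot_leUx.

Lemma lpi_morphI : {morph lpi : x y / lg_meet x y}.
Proof.
move=> x y; apply: le_anti; rewrite lg_lexI -lpi_lexI lexx /=.
by rewrite -[lg_meet (lpi x) _]lpi_repr lpi_lexI lpi_repr lg_leIl lg_leIr.
Qed.

Lemma lpi_morphU : {morph lpi : x y / lg_join x y}.
Proof.
move=> x y; apply: le_anti; rewrite lg_leUx -lpi_leUx lexx andbT.
by rewrite -[lg_join (lpi x) _]lpi_repr lpi_leUx lpi_repr lg_leUl lg_leUr.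
Qed.

HB.instance Definition _ := isLGroupMorphism.Build G lquot lpi lpi_morphI lpi_morphU.
End Quotient.

(* [div] represents the morphism div_A : K^* -> Div A, with K^* the group of
   regular elements of the total ring of fractions; its values outside of K^*
   are irrelevant. *)
Record is_divisor_map (A : comPzRingType) (D : lgroupType)
    (div : fracring A -> D) : Prop := {
  divM : forall x y, GRing.lreg x -> GRing.lreg y -> div (x * y) = div x + div y;
  div_ge0 : forall x, GRing.lreg x ->
    (0 <= div x <-> exists a, x = tofracring A a);
  (* the finite family x :: s is nonempty *)
  div_inf : forall alpha, exists x (s : seq (fracring A)),
    [/\ GRing.lreg x, forall y, y \in s -> GRing.lreg y
      & alpha = \big[@lg_meet D/div x]_(y <- s) div y] }.

Definition divA (A : comPzRingType) (D : lgroupType) (div : fracring A -> D)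
  (a : A) : D := div (tofracring A a).

Definition principal (A : comPzRingType) (D : lgroupType)
    (div : fracring A -> D) (alpha : D) :=
  exists2 x, GRing.lreg x & alpha = div x.

(* phi (div_A a) = div_(A_S) a for all a in A^*. *)
Definition extends_div (A : comPzRingType) (S : ring_filter A)
    (D DS : lgroupType) (div : fracring A -> D) (divS : fracring (loc S) -> DS)
    (phi : D -> DS) :=
  forall a : A, GRing.lreg a -> phi (divA div a) = divA divS (toloc S a).

Definition lg_surjective (G G' : Type) (f : G -> G') := forall y, exists x, f x = y.

Definition quotient_morphism (G G' : lgroupType) (f : {lgmorphism G -> G'})
    (H : set G) :=
  lg_surjective f /\ lg_ker f = H :> set G.

(* Main.v *)
Require Import Defs.
From HB Require Import structures.
From mathcomp Require Import all_boot all_order all_algebra.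
From mathcomp Require Import ring.
From mathcomp Require Import boolp classical_sets.
Set Implicit Arguments.
Unset Strict Implicit.
Unset Printing Implicit Defensive.
Import Order.TTheory GRing.Theory.
Local Open Scope classical_set_scope.
Local Open Scope ring_scope.

(* If (a_i c_k) has strong gcd g then, because every
   divisor is a supremum of principal ones, div g is the infimum of the
   div a_i + div c_k. Hence inf_i div a_i = div g - inf_k div c_k, and
   inf_i div a_i <= div b holds iff g divides every b c_k. Strong gcds survive
   localization, so such an inequality in Div A implies its analogue in Div A_S;
   writing divisors as inf_i div a_i - div d, this gives the map phi_S and its
   uniqueness, and it is surjective because div_{A_S} is trivial on S.
   Any alpha with phi_S alpha = 0 satisfies |alpha| <= div s for some s in S: write
   -|alpha| = inf_i div a_i - div d; then d divides a_i in A_S, so d divides s a_i in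
   A for one s in S and all i. Thus ker phi_S = H_S. *)

(** * Finite infima in lattice-ordered groups *)

Section LGroupInf.
Variable G : lgroupType.
Implicit Types (x y z : G) (l : seq G).

Lemma lg_leD2r z x y : (x + z <= y + z) = (x <= y).
Proof. by rewrite -[LHS]lg_subr_ge0 opprD addrACA subrr addr0 lg_subr_ge0. Qed.

Lemma lg_leBlD x y z : (x - y <= z) = (x <= z + y).
Proof. by rewrite -[LHS](lg_leD2r y) subrK. Qed.

Lemma lg_joinE x y : lg_join x y = - lg_meet (- x) (- y).
Proof.
apply: le_anti; rewrite lg_leUx -!(lg_opp (- lg_meet _ _)) opprK lg_leIl lg_leIr /=.
by rewrite -lg_opp opprK lg_lexI !lg_opp lg_leUl lg_leUr.
Qed.

Lemma lg_absB x y : lg_abs (x - y) <= lg_abs x + lg_abs y.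
Proof.
by rewrite lg_leUx opprB (addrC y) !lg_leD ?lg_leUl ?lg_leUr.
Qed.

(** A relation rather than an operation: one element may be presented as the infimum of several
    lists, and such presentations combine under concatenation, sums and translations. *)
Definition is_inf x l := forall z, z <= x <-> forall y, y \in l -> z <= y.

Lemma is_inf_le x l y : is_inf x l -> y \in l -> x <= y.
Proof. by move=> /(_ x)[/(_ (lexx x))+ _] => /[apply]. Qed.

Lemma is_inf_unique x y l : is_inf x l -> is_inf y l -> x = y.
Proof.
move=> xl yl; apply: le_anti; apply/andP.
by split; [apply/yl; apply/xl|apply/xl; apply/yl].
Qed.

Lemma is_inf1 x : is_inf x [:: x].
Proof. by move=> z; split=> [zx y /[!inE] /eqP-> //|]; apply; rewrite inE. Qed.

Lemma is_inf_big x l : is_inf (\big[@lg_meet G/x]_(y <- l) y) (x :: l).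
Proof.
move=> z; elim: l => [|y l IHl].
  by rewrite big_nil; exact: is_inf1.
rewrite big_cons lg_lexI; split=> [/andP[zy /IHl zl] t|zl].
  by rewrite !inE => /or3P[/eqP->|/eqP->//|tl]; apply: zl; rewrite inE ?eqxx ?tl ?orbT.
rewrite zl ?inE ?eqxx ?orbT //=; apply/IHl => t; rewrite inE => tl.
by apply: zl; rewrite !inE; case/orP: tl => ->; rewrite ?orbT.
Qed.

Lemma is_infI x y l m : is_inf x l -> is_inf y m -> is_inf (lg_meet x y) (l ++ m).
Proof.
move=> xl ym z; rewrite lg_lexI; split=> [/andP[/xl zl /ym zm] t|zlm].
  by rewrite mem_cat => /orP[/zl|/zm].
by apply/andP; split; [apply/xl|apply/ym] => t tl; apply: zlm; rewrite mem_cat tl ?orbT.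
Qed.

Lemma is_infD x y l m :
  is_inf x l -> is_inf y m -> is_inf (x + y) [seq a + b | a <- l, b <- m].
Proof.
move=> xl ym z; split=> [zxy t /allpairsP[[a b] /= [al bm ->]]|zlm].
  by apply: le_trans zxy _; apply: lg_leD; apply: is_inf_le; eassumption.
rewrite addrC -lg_leBlD; apply/ym => b bm.
rewrite lg_leBlD addrC -lg_leBlD; apply/xl => a al.
by rewrite lg_leBlD; apply: zlm; apply/allpairsP; exists (a, b).
Qed.

Lemma is_infDr x z l : is_inf x l -> is_inf (x + z) [seq y + z | y <- l].
Proof.
move=> xl t; rewrite -lg_leBlD; split=> [/xl tl y /mapP[a al ->]|tl].
  by rewrite -lg_leBlD; exact: tl.
by apply/xl => y yl; rewrite lg_leBlD; apply: tl; exact: map_f.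
Qed.

End LGroupInf.

(** * Morphisms, quotients by solid subgroups, and complements *)

Section Morphisms.
Variables G G' : lgroupType.

(** Additivity gives compatibility with opposites, and joins are opposites of meets of opposites
    ([lg_joinE]), so nothing has to be checked for them. *)
Lemma lg_morph_ex (f : G -> G') :
  {morph f : x y / x + y} -> {morph f : x y / lg_meet x y} ->
  exists F : {lgmorphism G -> G'}, F =1 f.
Proof.
move=> fD fI.
have f0 : f 0 = 0 by apply: (@addrI _ (f 0)); rewrite -fD !addr0.
have fN x : f (- x) = - f x by apply: (@addrI _ (f x)); rewrite -fD !subrr.
have fB : zmod_morphism f by move=> x y; rewrite fD fN.
have fU : {morph f : x y / lg_join x y} by move=> x y; rewrite !lg_joinE fN fI !fN.
pose mB := GRing.isZmodMorphism.Build G G' f fB.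
pose mI := isLGroupMorphism.Build G G' f fI fU.
pose F : {lgmorphism G -> G'} := HB.pack f mB mI.
by exists F.
Qed.

Variable f : {lgmorphism G -> G'}.

(** An infimum of the empty list would be a greatest element; it exists only when [G] is trivial,
    and its image need not be greatest in [G']. *)
Lemma lg_morph_inf x l :
  l <> [::] -> is_inf x l -> is_inf (f x) [seq f y | y <- l].
Proof.
case: l => // a l _ /is_inf_unique/(_ (is_inf_big a l)) ->.
rewrite (big_morph f (@lg_morphI _ _ f) (erefl (f a))) -(big_map f xpredT id).
exact: is_inf_big.
Qed.

End Morphisms.

Lemma lquot_iso (G G' : lgroupType) (f : {lgmorphism G -> G'}) (H : solidSubgroup G) :
  lg_surjective f -> (forall x, H x <-> f x = 0) ->
  exists g : {lgmorphism lquot H -> G'}, bijective g /\ forall x, g (lpi H x) = f x.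
Proof.
move=> fsurj Hf; pose h (X : lquot H) := f (repr X).
have hE x : h (lpi H x) = f x.
  apply/eqP; rewrite -subr_eq0 -raddfB; apply/eqP/Hf; apply/lpiP.
  exact: lpi_repr.
have hD : {morph h : X Y / X + Y}.
  by elim/lpiW=> x; elim/lpiW=> y; rewrite -raddfD !hE raddfD.
have hI : {morph h : X Y / lg_meet X Y}.
  by elim/lpiW=> x; elim/lpiW=> y; rewrite -lpi_morphI !hE lg_morphI.
have [g gE] := @lg_morph_ex (lquot H) G' h hD hI.
exists g; split=> [|x]; last by rewrite gE hE.
have [k fk] := choice fsurj.
exists (fun y => lpi H (k y)) => [|y]; last by rewrite gE hE fk.
by elim/lpiW=> x; rewrite gE hE; apply/lpiP/Hf; rewrite raddfB /= fk subrr.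
Qed.

(** The projection modulo [H] is onto from [L] because it kills the [H] component, and injective
    because [H] and [L] meet only in 0. *)
Lemma solid_complement_iso (G : lgroupType) (H : solidSubgroup G) (L : lsubgroup G) :
  orthogonal_sum H L ->
  exists g : {lgmorphism lsub L -> lquot H},
    bijective g /\ forall x, g x = lpi H (val x).
Proof.
move=> [HLsum HL0 _].
have [g gE] := @lg_morph_ex (lsub L) (lquot H) (fun x => lpi H (val x))
  (fun x y => etrans (congr1 (lpi H) (raddfD val x y)) (raddfD (lpi H) _ _))
  (fun x y => lpi_morphI H (val x) (val y)).
exists g; split=> //.
have /choice[k kP] : forall Y : lquot H, exists x : lsub L, g x = Y.
  elim/lpiW=> z; have [x [y [Hx Ly ->]]] := HLsum z.
  exists (LSub (asboolT Ly)); rewrite gE; apply/lpiP => /=.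
  by have [[H0 HB] _] := solidP H; rewrite opprD addrCA subrr addr0 -sub0r; apply: HB.
exists k => // x; apply/val_inj/eqP; rewrite -subr_eq0; apply/eqP.
have [_ LB] := lsub_subgroup L.
suff : (H `&` L) (val (k (g x)) - val x) by rewrite -meetEset HL0.
split; last by apply: LB; exact: lsubP.
by apply/lpiP; rewrite -!gE kP.
Qed.

(** * Regularity, divisibility and strong gcds in the localization *)

Section Loc.
Variables (A : comPzRingType) (S : ring_filter A).

Lemma tolocM a b : toloc S (a * b) = toloc S a * toloc S b.
Proof. exact: rmorphM. Qed.

Definition locnum (X : loc S) : A := Localization.num (repr X).
Definition locden (X : loc S) : A := Localization.den (repr X).

Lemma locdenP X : S (locden X).
Proof. exact: Localization.denP. Qed.

Lemma locden_num X : X * toloc S (locden X) = toloc S (locnum X).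
Proof.
rewrite -(locfracM (locnum X) (locdenP X)) -{1}[X]reprK; congr (_ * _).
exact: Localization.frac_ext.
Qed.

Lemma toloc_inverse s : S s -> exists Y, Y * toloc S s = 1.
Proof. by move=> Ss; exists (locfrac 1 Ss); rewrite locfracM rmorph1. Qed.

Lemma toloc_filter_lreg s : S s -> GRing.lreg (toloc S s).
Proof.
by move=> /toloc_inverse[Y Y1]; apply: (proj2 (proj1 (regularM Y _) _)); rewrite Y1; exact: lreg1.
Qed.

(** The product of the individual multipliers serves the whole list, as [P] survives further
    multiplication by elements of [S]. *)
Lemma filter_common (T : eqType) (P : A -> T -> Prop) (l : seq T) :
  (forall s t a, S s -> S t -> P s a -> P (t * s) a) ->
  (forall a, a \in l -> exists2 s, S s & P s a) ->
  exists2 s, S s & forall a, a \in l -> P s a.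
Proof.
move=> PM; elim: l => [|a l IHl] Pl; first by exists 1 => //; exact: filter1.
have [|s Ss sl] := IHl; first by move=> b bl; apply: Pl; rewrite inE bl orbT.
have [t St ta] := Pl a (mem_head _ _).
exists (s * t) => [|b]; first exact/filterM.
by rewrite inE => /orP[/eqP->|/sl]; [|rewrite mulrC]; apply: PM.
Qed.

Hypothesis Sreg : forall s, S s -> GRing.lreg s.

Lemma toloc_inj : injective (toloc S).
Proof.
move=> a b /(locfracP _ _ (filter1 S) (filter1 S))[u /Sreg ur].
by rewrite !mulr1 => /ur.
Qed.

Lemma toloc_lreg a : GRing.lreg (toloc S a) <-> GRing.lreg a.
Proof.
split=> [ar u v /= /(congr1 (toloc S))|ar X Y /=]; first by rewrite !tolocM => /ar/toloc_inj.
(* Multiplying by both denominators, which are units in [loc S], brings the equation back to [A],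
   where [a] can be cancelled. *)
move=> /(congr1 (fun Z => Z * toloc S (locden X) * toloc S (locden Y))) aXY.
apply: (toloc_filter_lreg (locdenP X)); apply: (toloc_filter_lreg (locdenP Y)).
transitivity (toloc S (locnum X * locden Y)).
  by rewrite tolocM -locden_num; ring.
transitivity (toloc S (locnum Y * locden X)); last by rewrite tolocM -locden_num; ring.
congr (toloc S _); apply: ar; apply: toloc_inj; rewrite /= !tolocM -!locden_num.
by move: aXY; rewrite !mulrA => ->; ring.
Qed.

Lemma loc_lreg X : GRing.lreg X <-> GRing.lreg (locnum X).
Proof.
rewrite -toloc_lreg -locden_num; split=> [Xr|/regularM[] //].
by apply/regularM; split=> //; apply: toloc_filter_lreg; exact: locdenP.
Qed.

Lemma toloc_divides a b :
  divides (toloc S a) (toloc S b) <-> exists2 s, S s & divides a (s * b).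
Proof.
split=> [[Z bZ]|[s Ss [c sb]]].
  exists (locden Z); first exact: locdenP.
  by exists (locnum Z); apply: toloc_inj; rewrite !tolocM -locden_num bZ; ring.
have [Y Y1] := toloc_inverse Ss; exists (toloc S c * Y).
by rewrite mulrA -tolocM -sb tolocM mulrC mulrA Y1 mul1r.
Qed.

(** An element of [loc S] and its numerator differ by the denominator, which is a unit. *)
Lemma loc_divides Y b :
  divides Y (toloc S b) <-> exists2 s, S s & divides (locnum Y) (s * b).
Proof.
rewrite -toloc_divides -locden_num; have [V V1] := toloc_inverse (locdenP Y).
split=> -[T ->]; last by exists (toloc S (locden Y) * T); rewrite mulrA.
by exists (V * T); rewrite -[LHS]mul1r -V1; ring.
Qed.

Lemma loc_divides_unitr Y Z s : S s -> divides Y (Z * toloc S s) <-> divides Y Z.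
Proof.
move=> /toloc_inverse[V V1]; split=> [[T ZT]|[T ->]].
  by exists (T * V); rewrite -[LHS]mulr1 -V1 mulrA (mulrAC Z) ZT; ring.
by exists (T * toloc S s); rewrite mulrA.
Qed.

(** Clearing denominators turns divisibility of [X * z] by [Y] into divisibility of
    [s * locnum X * z] by [locnum Y] for some [s] in [S]. The multiplier [s * locnum X] is regular,
    so strength of the gcd in [A] applies to it, and [filter_common] provides one [s] for the whole
    list. *)
Lemma strong_gcd_toloc g l :
  is_strong_gcd g l -> is_strong_gcd (toloc S g) [seq toloc S a | a <- l].
Proof.
move=> [gr gcdg]; split=> [|X /loc_lreg Xr Y]; first exact/toloc_lreg.
have divE z : divides Y (X * toloc S z) <->
    exists2 s, S s & divides (locnum Y) (s * locnum X * z).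
  rewrite -(loc_divides_unitr _ _ (locdenP X)) mulrAC locden_num -tolocM loc_divides.
  by split=> -[s Ss]; exists s => //; rewrite ?mulrA // -mulrA.
have gcds s : S s -> is_gcd (s * locnum X * g) [seq s * locnum X * a | a <- l].
  by move=> Ss; apply: gcdg; apply/regularM; split=> //; exact: Sreg.
split=> [/divE[s Ss /(gcds _ Ss) YX] _ /mapP[_ /mapP[a al ->] ->]|YX].
  by apply/divE; exists s => //; apply: YX; exact: map_f.
have [||s Ss sl] := @filter_common _ (fun s a => divides (locnum Y) (s * locnum X * a)) l.
- by move=> s t a _ _ [c e]; exists (t * c); rewrite mulrCA -e !mulrA.
- by move=> a al; apply/divE; apply: YX; do 2!apply: map_f.
apply/divE; exists s => //; apply/gcds => // _ /mapP[a al ->]; exact: sl.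
Qed.

Lemma loc_integral : integral_ring A -> integral_ring (loc S).
Proof.
move=> intA X; have [X0|/loc_lreg Xr] := intA (locnum X); [left|by right].
have [Y Y1] := toloc_inverse (locdenP X).
by rewrite -[X]mulr1 -Y1 mulrCA locden_num X0 raddf0 mulr0.
Qed.

Lemma loc_ring_with_divisors : ring_with_divisors A -> ring_with_divisors (loc S).
Proof.
move=> [intA divA_]; split=> [|l l0 lr]; first exact: loc_integral.
have [||m mr [g gcdg]] := divA_ [seq locnum X | X <- l].
- by case: l l0 {lr}.
- by move=> _ /mapP[X Xl ->]; apply/loc_lreg; exact: lr.
exists [seq toloc S b | b <- m].
  by move=> _ /mapP[b bm ->]; apply/toloc_lreg; exact: mr.
exists (toloc S g); have [gr gcdS] := strong_gcd_toloc gcdg; split=> // X Xr Y.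
rewrite (gcdS X Xr Y).
(* The chosen gcd is the one of the numerators; replacing [Z] by its numerator multiplies by a unit
   and does not affect divisibility by [Y]. *)
have assoc Z b : divides Y (X * (Z * toloc S b)) <-> divides Y (X * toloc S (locnum Z * b)).
  rewrite -(loc_divides_unitr Y (X * (Z * toloc S b)) (locdenP Z)) tolocM -locden_num.
  suff -> : X * (Z * toloc S b) * toloc S (locden Z)
          = X * (Z * toloc S (locden Z) * toloc S b) by [].
  by ring.
split=> [YX _ /mapP[_ /allpairsP[[Z _] /= [Zl /mapP[b bm ->] ->]] ->]|YX].
  by apply/assoc; apply: YX; do 2!apply: map_f; apply: allpairs_f => //; exact: map_f.
move=> _ /mapP[_ /mapP[_ /allpairsP[[_ b] /= [/mapP[Z Zl ->] bm ->]] ->] ->].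
by apply/assoc; apply: YX; apply: map_f; apply: allpairs_f => //; exact: map_f.
Qed.

End Loc.

(** * The divisor map: divisibility and gcds read in Div A *)

Section Div.
Variables (A : comPzRingType) (D : lgroupType) (div : fracring A -> D).
Hypothesis hdiv : is_divisor_map div.
Implicit Types (a b : A) (x y : fracring A) (alpha beta : D).

Local Notation iota := (tofracring A).
Local Notation dA := (divA div).

Lemma iota_lreg a : GRing.lreg (iota a) <-> GRing.lreg a.
Proof. exact: toloc_lreg. Qed.

Lemma iota_inj : injective iota.
Proof. exact: toloc_inj. Qed.

Lemma divAM a b : GRing.lreg a -> GRing.lreg b -> dA (a * b) = dA a + dA b.
Proof. by move=> /iota_lreg ar /iota_lreg br; rewrite /divA rmorphM (divM hdiv). Qed.

Lemma div_frac x : GRing.lreg x ->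
  exists a b, [/\ GRing.lreg a, GRing.lreg b, x * iota b = iota a & div x = dA a - dA b].
Proof.
move=> xr; exists (locnum x), (locden x).
have ar : GRing.lreg (locnum x) by apply/loc_lreg.
have br : GRing.lreg (locden x) := locdenP x.
split=> //; first exact: locden_num.
have ibr : GRing.lreg (iota (locden x)) by apply/iota_lreg.
apply: (@addIr _ (dA (locden x))); rewrite subrK /divA -locden_num.
by rewrite (divM hdiv xr ibr).
Qed.

Lemma div_frac_ex a b : GRing.lreg a -> GRing.lreg b ->
  exists2 x, GRing.lreg x & div x = dA a - dA b.
Proof.
move=> ar br; pose x := @locfrac A (regular_filter A) a b br.
have xb : x * iota b = iota a := locfracM a (br : regular_filter A b).
have xr : GRing.lreg x.
  by apply: (proj1 (proj1 (regularM x (iota b)) _)); rewrite xb; apply/iota_lreg.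
have ibr : GRing.lreg (iota b) by apply/iota_lreg.
by exists x => //; apply: (@addIr _ (dA b)); rewrite subrK /divA -xb (divM hdiv xr ibr).
Qed.

Lemma divA_le a b : GRing.lreg a -> GRing.lreg b -> dA a <= dA b <-> divides a b.
Proof.
move=> ar br; split=> [|[c bac]]; last first.
  have cr : GRing.lreg c by have /regularM[] : GRing.lreg (a * c) by rewrite -bac.
  rewrite bac divAM // -[leLHS]addr0 lg_leD2 //.
  by apply/(div_ge0 hdiv); [exact/iota_lreg|exists c].
(* [Y] is 1/a in the total ring of fractions: [dA a <= dA b] says that b/a has a nonnegative
   divisor, hence lies in [A]. *)
have [Y Y1] := @toloc_inverse A (regular_filter A) a ar.
have Yr : GRing.lreg Y.
  by apply: (proj1 (proj1 (regularM Y (iota a)) _)); rewrite Y1; exact: lreg1.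
have div1 : div 1 = 0.
  apply: (@addrI _ (div 1)).
  by rewrite -(divM hdiv) ?mulr1 ?addr0 //; exact: regular1.
have divY : div Y = - dA a.
  by apply/eqP; rewrite -addr_eq0 -(divM hdiv) ?Y1 ?div1 //; exact/iota_lreg.
have bY : GRing.lreg (iota b * Y) by apply/regularM; split=> //; exact/iota_lreg.
rewrite -lg_subr_ge0 -divY -(divM hdiv) //; last exact/iota_lreg.
move=> /(div_ge0 hdiv bY)[c bYc]; exists c; apply: iota_inj.
by rewrite /= rmorphM /= -bYc mulrCA (mulrC _ Y) Y1 mulr1.
Qed.

Lemma divA_ge0 a : GRing.lreg a -> 0 <= dA a.
Proof.
by move=> ar; apply/(div_ge0 hdiv); [exact/iota_lreg|exists a].
Qed.

(** Every divisor is a supremum of principal ones: [- alpha] is the infimum of finitely many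
    [div y], so [alpha] is the supremum of the divisors of the inverses of these [y]. *)
Lemma le_of_div alpha beta :
  (forall x, GRing.lreg x -> div x <= alpha -> div x <= beta) -> alpha <= beta.
Proof.
move=> le_ab; have [x [l [xr lr e]]] := div_inf hdiv (- alpha).
have {}e : is_inf (- alpha) [seq div y | y <- x :: l].
  by rewrite e -(big_map div xpredT id); exact: is_inf_big.
rewrite -lg_opp; apply/e => _ /mapP[y yl ->].
have yr : GRing.lreg y by move: yl; rewrite inE => /orP[/eqP->|/lr].
have [a [b [ar br _ ye]]] := div_frac yr; have [z zr ze] := div_frac_ex br ar.
rewrite -[leRHS]opprK lg_opp ye opprB -ze; apply: le_ab => //.
rewrite ze -(opprB (dA a)) -ye -[leRHS]opprK lg_opp.
by apply: is_inf_le e _; exact: map_f.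
Qed.

(** By [le_of_div] it suffices to test lower bounds of the form div (p/q). Such a bound means that p
    divides every [q * a]; since [q * g] is a gcd of these products, p divides [q * g]. *)
Lemma strong_gcd_inf g l : (forall a, a \in l -> GRing.lreg a) ->
  is_strong_gcd g l -> is_inf (dA g) [seq dA a | a <- l].
Proof.
move=> lr [gr gcdg] z; split=> [zg _ /mapP[a al ->]|zl].
  apply: le_trans zg _; apply/divA_le => //; first exact: lr.
  have /(_ g)[] := gcdg _ (@regular1 A); rewrite mul1r => + _.
  by apply; [exists 1; rewrite mulr1|apply/mapP; exists a; rewrite ?mul1r].
apply: le_of_div => x xr; have [p [q [pr qr _ ->]]] := div_frac xr => pqz.
have qgr : GRing.lreg (q * g) by apply/regularM.
rewrite lg_leBlD addrC -divAM //; apply/divA_le => //; apply/gcdg => // _ /mapP[a al ->].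
have ar := lr _ al; apply/divA_le => //; first exact/regularM.
by rewrite divAM // addrC -lg_leBlD (le_trans pqz) //; apply: zl; exact: map_f.
Qed.

Lemma div_ind (P : D -> Prop) :
  (forall a b, GRing.lreg a -> GRing.lreg b -> P (dA a - dA b)) ->
  (forall alpha beta, P alpha -> P beta -> P (lg_meet alpha beta)) ->
  forall alpha, P alpha.
Proof.
move=> Pdiv PI alpha; have [x [l [xr lr ->]]] := div_inf hdiv alpha.
have Pd y : GRing.lreg y -> P (div y) by move=> /div_frac[a [b [ar br _ ->]]]; exact: Pdiv.
by rewrite big_seq; apply: big_ind => [|//|y yl]; apply: Pd => //; exact: lr.
Qed.

End Div.

(** * Construction, uniqueness, surjectivity and kernel of phi_S *)

Section Extension.
Variables (A : comPzRingType) (S : ring_filter A).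
Variables (D : lgroupType) (div : fracring A -> D).
Variables (DS : lgroupType) (divS : fracring (loc S) -> DS).
Hypotheses (hA : ring_with_divisors A) (Sreg : forall s, S s -> GRing.lreg s).
Hypotheses (hdiv : is_divisor_map div) (hdivS : is_divisor_map divS).
Implicit Types (a b d : A) (alpha : D) (beta : DS).

Local Notation dA := (divA div).
Local Notation dS a := (divA divS (toloc S a)).

Lemma divSM a b : GRing.lreg a -> GRing.lreg b -> dS (a * b) = dS a + dS b.
Proof. by move=> ar br; rewrite tolocM (divAM hdivS) //; exact/toloc_lreg. Qed.

Lemma divS_le a b : GRing.lreg a -> GRing.lreg b ->
  dS a <= dS b <-> exists2 s, S s & divides a (s * b).
Proof.
move=> ar br; rewrite -(toloc_divides Sreg).
by apply: (divA_le hdivS); exact/toloc_lreg.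
Qed.

Lemma divS_filter s : S s -> dS s = 0.
Proof.
move=> Ss; have sr := Sreg Ss; have r1 := @regular1 A.
have d1 : dS 1 = 0 by apply: (@addrI _ (dS 1)); rewrite -divSM // mulr1 addr0.
apply: le_anti; rewrite -d1; apply/andP; split; apply/divS_le => //.
  (* [s] divides [s * 1], hence it divides 1 after localization. *)
  by exists s => //; exists 1.
by exists 1; [exact: filter1|exists s; rewrite !mul1r].
Qed.

(* The graph of phi_S: alpha and beta are the same formal combination
   inf_i (div a_i) - div d, read in Div A and in Div A_S respectively. *)
Definition ext_graph alpha beta := exists d l,
  [/\ GRing.lreg d, l <> [::], forall a, a \in l -> GRing.lreg a,
      is_inf (alpha + dA d) [seq dA a | a <- l]
    & is_inf (beta + dS d) [seq dS a | a <- l]].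

Lemma ext_graph_div a b : GRing.lreg a -> GRing.lreg b ->
  ext_graph (dA a - dA b) (dS a - dS b).
Proof.
move=> ar br; exists b, [:: a]; split=> // [c /[!inE] /eqP-> //||].
  by rewrite subrK; exact: is_inf1.
by rewrite subrK; exact: is_inf1.
Qed.

Lemma map_divAM d l : GRing.lreg d -> (forall a, a \in l -> GRing.lreg a) ->
  [seq dA a | a <- [seq a * d | a <- l]] = [seq y + dA d | y <- [seq dA a | a <- l]].
Proof.
move=> dr lr; rewrite -!map_comp; apply/eq_in_map => a al /=.
by rewrite (divAM hdiv) //; exact: lr.
Qed.

Lemma map_divSM d l : GRing.lreg d -> (forall a, a \in l -> GRing.lreg a) ->
  [seq dS a | a <- [seq a * d | a <- l]] = [seq y + dS d | y <- [seq dS a | a <- l]].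
Proof.
move=> dr lr; rewrite -!map_comp; apply/eq_in_map => a al /=.
by rewrite divSM //; exact: lr.
Qed.

Lemma mulr_list_lreg d l : GRing.lreg d -> (forall a, a \in l -> GRing.lreg a) ->
  forall a, a \in [seq a * d | a <- l] -> GRing.lreg a.
Proof. by move=> dr lr _ /mapP[a al ->]; apply/regularM; split=> //; exact: lr. Qed.

(** Both presentations are brought to the common denominator [d * d'], and the numerators are
    concatenated. *)
Lemma ext_graphI alpha beta alpha' beta' :
  ext_graph alpha beta -> ext_graph alpha' beta' ->
  ext_graph (lg_meet alpha alpha') (lg_meet beta beta').
Proof.
move=> [d [l [dr l0 lr la lb]]] [d' [l' [d'r l'0 l'r la' lb']]].
exists (d * d'), ([seq a * d' | a <- l] ++ [seq a * d | a <- l']); split.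
- exact/regularM.
- by case: l l0 {lr la lb}.
- by move=> a; rewrite mem_cat => /orP[]; apply: mulr_list_lreg.
- rewrite map_cat !map_divAM // (divAM hdiv) // addrC lg_meetD.
  rewrite [X in lg_meet X]addrC addrA [X in lg_meet _ X]addrC (addrC (dA d)) addrA.
  by apply: is_infI; exact: is_infDr.
- rewrite map_cat !map_divSM // divSM // addrC lg_meetD.
  rewrite [X in lg_meet X]addrC addrA [X in lg_meet _ X]addrC (addrC (dS d)) addrA.
  by apply: is_infI; exact: is_infDr.
Qed.

(** Denominators are multiplied, and the infima are added through all pairwise products of
    numerators. *)
Lemma ext_graphD alpha beta alpha' beta' :
  ext_graph alpha beta -> ext_graph alpha' beta' ->
  ext_graph (alpha + alpha') (beta + beta').
Proof.
move=> [d [l [dr l0 lr la lb]]] [d' [l' [d'r l'0 l'r la' lb']]].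
exists (d * d'), [seq a * b | a <- l, b <- l']; split.
- exact/regularM.
- by case: l l0 l' l'0 {lr la lb l'r la' lb'} => [|? ?] // _ [].
- by move=> _ /allpairsP[[a b] /= [al bl ->]]; apply/regularM; split; [apply: lr|apply: l'r].
- rewrite (divAM hdiv) // addrACA.
  suff -> : [seq dA c | c <- [seq a * b | a <- l, b <- l']]
      = [seq y + z | y <- [seq dA a | a <- l], z <- [seq dA b | b <- l']].
    exact: is_infD.
  rewrite map_allpairs allpairs_mapl allpairs_mapr.
  by apply/eq_in_allpairs => a b al bl /=; rewrite (divAM hdiv) //; [apply: lr|apply: l'r].
- rewrite divSM // addrACA.
  suff -> : [seq dS c | c <- [seq a * b | a <- l, b <- l']]
      = [seq y + z | y <- [seq dS a | a <- l], z <- [seq dS b | b <- l']].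
    exact: is_infD.
  rewrite map_allpairs allpairs_mapl allpairs_mapr.
  by apply/eq_in_allpairs => a b al bl /=; rewrite divSM //; [apply: lr|apply: l'r].
Qed.

Lemma ext_graph_total alpha : exists beta, ext_graph alpha beta.
Proof.
move: alpha; apply: (div_ind hdiv) => [a b ar br|alpha alpha' [beta e] [beta' e']].
  by eexists; exact: ext_graph_div.
by eexists; exact: ext_graphI e e'.
Qed.

Lemma ext_graph_surj beta : exists alpha, ext_graph alpha beta.
Proof.
move: beta; apply: (div_ind hdivS) => [X Y Xr Yr|beta beta' [alpha e] [alpha' e']].
  (* This is X/Y with denominators cleared by cross-multiplication; the factors [locden X] and
     [locden Y] lie in [S], so they contribute 0 in [DS]. *)
  exists (dA (locnum X * locden Y) - dA (locnum Y * locden X)).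
  have Zr (Z : loc S) : GRing.lreg Z -> GRing.lreg (locnum Z) /\ GRing.lreg (locden Z).
    by move=> Zr; split; [exact/loc_lreg|apply: Sreg; exact: locdenP].
  have divE Z : GRing.lreg Z -> divA divS Z = dS (locnum Z).
    move=> /[dup] Zreg /Zr[_ dr]; rewrite -locden_num (divAM hdivS) //; last exact/toloc_lreg.
    by rewrite divS_filter ?addr0 //; exact: locdenP.
  have [[nX dX] [nY dY]] := (Zr _ Xr, Zr _ Yr).
  have -> : divA divS X - divA divS Y
          = dS (locnum X * locden Y) - dS (locnum Y * locden X).
    rewrite (divSM nX dY) (divSM nY dX) (divS_filter (locdenP X)).
    by rewrite (divS_filter (locdenP Y)) !addr0 (divE _ Xr) (divE _ Yr).
  by apply: ext_graph_div; exact/regularM.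
by eexists; exact: ext_graphI e e'.
Qed.

(** Monotonicity is what makes the graph single-valued. With [g] a strong gcd of the products of [l]
    and [t], the inequality in [D] yields that [g * d'] divides [b * d * c] in [A] for all [b] in
    [l'] and [c] in [t]. These divisibilities persist in [loc S], where [g] is still a strong gcd,
    and there they give back the inequality. *)
Lemma ext_graph_homo alpha beta alpha' beta' :
  ext_graph alpha beta -> ext_graph alpha' beta' -> alpha <= alpha' -> beta <= beta'.
Proof.
move=> [d [l [dr l0 lr la lb]]] [d' [l' [d'r l'0 l'r la' lb']]] le_aa.
have [t tr [g gcdg]] := proj2 hA l l0 lr.
have ltr a : a \in [seq a * c | a <- l, c <- t] -> GRing.lreg a.
  by move=> /allpairsP[[b c] /= [bl ct ->]]; apply/regularM; split; [apply: lr|apply: tr].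
have gA := strong_gcd_inf hdiv ltr gcdg.
have gS : is_inf (dS g) [seq dS a | a <- [seq a * c | a <- l, c <- t]].
  have := strong_gcd_inf hdivS _ (strong_gcd_toloc Sreg gcdg).
  by rewrite -map_comp; apply=> _ /mapP[a /ltr ar ->]; apply/toloc_lreg.
have gr := proj1 gcdg.
rewrite -(lg_leD2r (dS d')); apply/lb' => _ /mapP[b bl ->]; have br := l'r _ bl.
have gbc c : c \in t -> dS g + dS d' <= dS b + dS d + dS c.
  move=> ct; have cr := tr _ ct.
  have gdr : GRing.lreg (g * d') by apply/regularM.
  have bdr : GRing.lreg (b * d) by apply/regularM.
  have bdcr : GRing.lreg (b * d * c) by apply/regularM.
  rewrite -!divSM //; apply/divS_le => //; exists 1; first exact: filter1.
  rewrite mul1r; apply/(divA_le hdiv) => //; rewrite !(divAM hdiv) //.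
  (* Since [dA g] lies below [dA a + dA c] for every [a], the element [dA g - dA c] is a lower bound
     of all [dA a], hence lies below their infimum. *)
  have glc : dA g <= alpha + dA d + dA c.
    rewrite -lg_leBlD; apply/la => _ /mapP[a al ->].
    rewrite lg_leBlD -(divAM hdiv) //; last exact: lr.
    by apply: is_inf_le gA _; apply: map_f; exact: allpairs_f.
  have bd : alpha + dA d' <= dA b.
    apply: (@le_trans _ _ (alpha' + dA d')); first by rewrite lg_leD2r.
    by apply: is_inf_le la' _; exact: map_f.
  apply: (@le_trans _ _ (alpha + dA d + dA c + dA d')); first by rewrite lg_leD2r.
  by rewrite -(addrA alpha) addrAC -(addrA (dA b)) lg_leD2r.
(* A lower bound of each [dS (a * c)]: [beta + dS d] is below [dS a], and the bracket is below
   [dS c] by [gbc]. Cancelling [dS g] and [dS d] leaves the required [beta + dS d' <= dS b]. *)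
have : beta + dS d + (dS g + dS d' - (dS b + dS d)) <= dS g.
  apply/gS => _ /mapP[_ /allpairsP[[a c] /= [al ct ->]] ->].
  rewrite divSM; [|exact: lr|exact: tr].
  apply: lg_leD; first by apply: is_inf_le lb _; exact: map_f.
  by rewrite lg_leBlD [leRHS]addrC gbc.
rewrite addrA lg_leBlD (addrC (dS g)) addrA (addrC (dS g)) lg_leD2r.
by rewrite addrAC lg_leD2r.
Qed.

Lemma ext_graph_fun alpha beta beta' :
  ext_graph alpha beta -> ext_graph alpha beta' -> beta = beta'.
Proof.
by move=> e e'; apply: le_anti; rewrite (ext_graph_homo e e') // (ext_graph_homo e' e).
Qed.

(** A morphism preserves finite infima, so it carries each formal combination over [D] to the same
    one over [DS]. Thus every extension has [ext_graph] as its graph, which gives uniqueness. *)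
Lemma extends_divE (phi : {lgmorphism D -> DS}) alpha beta :
  extends_div div divS phi -> ext_graph alpha beta <-> phi alpha = beta.
Proof.
move=> phidiv; have sub beta' : ext_graph alpha beta' -> phi alpha = beta'.
  move=> [d [l [dr l0 lr la lb]]]; apply: (@addIr _ (dS d)).
  apply: is_inf_unique lb; rewrite -phidiv // -raddfD.
  have -> : [seq dS a | a <- l] = [seq phi y | y <- [seq dA a | a <- l]].
    by rewrite -map_comp; apply/eq_in_map => a al /=; rewrite phidiv //; exact: lr.
  by apply: lg_morph_inf la; case: l l0 {lr}.
split=> [/sub //|<-]; have [beta' e] := ext_graph_total alpha.
by rewrite (sub _ e).
Qed.

Lemma extends_div_ex : exists phi : {lgmorphism D -> DS}, extends_div div divS phi.
Proof.
have [f fP] := choice ext_graph_total.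
have fD : {morph f : x y / x + y}.
  by move=> x y; apply: ext_graph_fun (fP _) _; apply: ext_graphD.
have fI : {morph f : x y / lg_meet x y}.
  by move=> x y; apply: ext_graph_fun (fP _) _; apply: ext_graphI.
have [phi phiE] := lg_morph_ex fD fI; exists phi => a ar; rewrite phiE.
(* Here [a] is read as a/1, and 1 has divisor 0 on both sides. *)
apply: ext_graph_fun (fP _) _; have := ext_graph_div ar (@regular1 A).
have d1 : dA 1 = 0.
  by apply: (@addrI _ (dA 1)); rewrite -(divAM hdiv) ?mulr1 ?addr0 //; exact: regular1.
by rewrite d1 (divS_filter (filter1 S)) !subr0.
Qed.

Lemma extends_div_surj (phi : {lgmorphism D -> DS}) :
  extends_div div divS phi -> lg_surjective phi.
Proof.
move=> phidiv beta; have [alpha e] := ext_graph_surj beta.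
by exists alpha; exact/(extends_divE _ _ phidiv).
Qed.

Lemma extends_div_ker (phi : {lgmorphism D -> DS}) alpha :
  extends_div div divS phi -> phi alpha = 0 -> exists2 s, S s & lg_abs alpha <= dA s.
Proof.
(* The opposite of the absolute value is used because presentations are infima: bounding one from
   below bounds [lg_abs alpha] from above. *)
move=> phidiv phia; have: ext_graph (- lg_abs alpha) 0.
  by apply/(extends_divE _ _ phidiv); rewrite raddfN /= lg_morph_abs phia [lg_abs 0]lg_abs_id ?oppr0.
move=> [d [l [dr _ lr la lb]]].
have [||s Ss sl] := @filter_common _ S _ (fun s a => divides d (s * a)) l.
- by move=> s t a _ _ [c e]; exists (t * c); rewrite mulrCA -e !mulrA.
- move=> a al; apply/divS_le => //; first exact: lr.
  by rewrite -[leLHS]add0r; apply: is_inf_le lb _; exact: map_f.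
exists s => //; have sr := Sreg Ss.
suff : dA d - dA s <= - lg_abs alpha + dA d.
  by rewrite addrC lg_leD2r lg_opp.
apply/la => _ /mapP[a al ->]; rewrite lg_leBlD -(divAM hdiv) //; last exact: lr.
rewrite mulrC; apply/(divA_le hdiv) => //; last exact: sl.
by apply/regularM; split=> //; exact: lr.
Qed.

End Extension.

(** * The solid subgroup generated by the divisors of a filter *)

Section SolidFilter.
Variables (A : comPzRingType) (S : ring_filter A).
Variables (D : lgroupType) (div : fracring A -> D).
Hypotheses (Sreg : forall s, S s -> GRing.lreg s) (hdiv : is_divisor_map div).

Local Notation dA := (divA div).

(** The elements bounded by some [dA s] already form a solid subgroup: bounds [dA s] and [dA t] for
    two elements give the bound [dA (s * t)] for their difference. *)
Lemma solid_filterE (alpha : D) :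
  solid_gen [set dA s | s in S] alpha <-> exists2 s, S s & lg_abs alpha <= dA s.
Proof.
split=> [Halpha|[s Ss le_s]].
  apply: (Halpha [set x | exists2 s, S s & lg_abs x <= dA s]); split; last first.
    by move=> _ [s Ss <-]; exists s => //; rewrite lg_abs_id // (divA_ge0 hdiv) //; exact: Sreg.
  split; last by move=> x y [s Ss xs] yx; exists s => //; exact: le_trans xs.
  split=> [|x y [s Ss xs] [t St yt]].
    exists 1; first exact: filter1.
    by rewrite [lg_abs 0]lg_abs_id // (divA_ge0 hdiv) //; exact: regular1.
  exists (s * t); first exact/filterM.
  rewrite (divAM hdiv) ?(le_trans (lg_absB x y)) ?lg_leD //; exact: Sreg.
have [_ sol] := solidP (solid_gen [set dA s | s in S]).
apply: (sol (dA s)); last by rewrite [leRHS]lg_abs_id // (divA_ge0 hdiv) //; exact: Sreg.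
by move=> M [_]; apply; exists s.
Qed.

Lemma positive_solid_filter :
  positive_part (solid_gen [set dA s | s in S])
    = [set alpha | exists2 s, S s & 0 <= alpha <= dA s].
Proof.
apply/seteqP; split=> [alpha [/solid_filterE[s Ss le_s] a0]|alpha [s Ss /andP[a0 le_s]]].
  by exists s => //; rewrite a0 -(lg_abs_id a0).
by split=> //; apply/solid_filterE; exists s; rewrite ?lg_abs_id.
Qed.

Lemma principal_solid_filter :
  [set alpha | positive_part (solid_gen [set dA s | s in S]) alpha /\ principal div alpha]
    = [set dA s | s in S].
Proof.
rewrite positive_solid_filter.
apply/seteqP; split=> [alpha [[s Ss /andP[x0 xs]] [x xr xE]]|_ [s Ss <-]]; last first.
  have sr := Sreg Ss; split; last by exists (tofracring A s) => //; exact/iota_lreg.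
  by exists s => //; rewrite lexx andbT (divA_ge0 hdiv).
move: x0 xs; rewrite xE => x0 xs; have [a xa] := (div_ge0 hdiv xr).1 x0.
have ar : GRing.lreg a by apply/iota_lreg; rewrite -xa.
exists a; last by rewrite /divA xa.
rewrite xa in xs; have [c sac] := (divA_le hdiv ar (Sreg Ss)).1 xs.
(* Here [a] divides [s], and saturation of the filter puts [a] in [S]. *)
by move: Ss; rewrite sac => /filterM[].
Qed.

End SolidFilter.

Theorem mainTheorem11 (A : comPzRingType) (S : ring_filter A)
    (D : lgroupType) (div : fracring A -> D)
    (hA : ring_with_divisors A) (hS : ~ S 0) (hdiv : is_divisor_map div) :
  let HS : solidSubgroup D := solid_gen [set divA div s | s in S] in
  [/\ ring_with_divisors (loc S) /\
      (forall (DS : lgroupType) (divS : fracring (loc S) -> DS),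
        is_divisor_map divS ->
        (exists phi : {lgmorphism D -> DS}, extends_div div divS phi /\
          forall psi : {lgmorphism D -> DS},
            extends_div div divS psi -> psi =1 phi) /\
        (forall phi : {lgmorphism D -> DS}, extends_div div divS phi ->
          lg_surjective phi /\
          exists f : {lgmorphism lquot (lg_ker phi) -> DS},
            bijective f /\ forall alpha, f (lpi (lg_ker phi) alpha) = phi alpha)),
      positive_part HS
        = [set alpha | exists2 s, S s & 0 <= alpha <= divA div s] /\
      [set alpha | positive_part HS alpha /\ principal div alpha]
        = [set divA div s | s in S]
    & forall (H' : lsubgroup D), orthogonal_sum HS H' ->
      (forall (DS : lgroupType) (divS : fracring (loc S) -> DS)
          (phi : {lgmorphism D -> DS}),
        is_divisor_map divS -> extends_div div divS phi ->
        quotient_morphism phi HS /\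
        exists f : {lgmorphism lquot HS -> DS},
          bijective f /\ forall alpha, f (lpi HS alpha) = phi alpha) /\
      exists g : {lgmorphism lsub H' -> lquot HS},
        bijective g /\ forall beta, g beta = lpi HS (val beta) ].
Proof.
(* In an integral ring a non-regular element is 0, which [S] omits; hence [S] consists of regular
   elements. *)
move=> HS; have Sreg s : S s -> GRing.lreg s by case: (proj1 hA s) => // ->.
split=> [||H' HSH'].
- split=> [|DS divS hdivS]; first exact: loc_ring_with_divisors.
  split=> [|phi phidiv].
    have [phi phidiv] := extends_div_ex hA Sreg hdiv hdivS.
    exists phi; split=> // psi psidiv alpha.
    by apply/(extends_divE Sreg hdiv hdivS _ _ psidiv)/(extends_divE Sreg hdiv hdivS _ _ phidiv).
  have phisurj := extends_div_surj Sreg hdiv hdivS phidiv.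
  by split=> //; exact: lquot_iso.
- by split; [exact: positive_solid_filter|exact: principal_solid_filter].
split=> [DS divS phi hdivS phidiv|]; last exact: solid_complement_iso.
have phisurj := extends_div_surj Sreg hdiv hdivS phidiv.
have HSker alpha : HS alpha <-> phi alpha = 0.
  split=> [|phia]; last first.
    by apply/(solid_filterE Sreg hdiv); exact: extends_div_ker phidiv phia.
  (* The kernel is solid and contains the generators of [HS], since elements of [S] have divisor 0
     in [DS]; it therefore contains [HS]. *)
  move=> /(_ (lg_ker phi)); apply; split; first exact: solidP.
  by move=> _ [s Ss <-] /=; rewrite phidiv ?(divS_filter Sreg hdivS) //; exact: Sreg.
split; last exact: lquot_iso.
by split=> //; apply/seteqP; split=> alpha /HSker.
Qed.
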